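(* Let $q$ be an odd prime power and $d\ge 3$ an integer, and suppose that either $q\equiv 1\pmod 4$ and $d$ is odd, or $q\equiv 3\pmod 4$ and $d\equiv 1\pmod 4$. Then there exists a subset $\mathcal{P}\subseteq\mathbb{F}_q^d$ with $|\mathcal{P}|=q^{(d+1)/2}$ such that the number of distinct spreads determined by points of $\mathcal{P}$ is at most one.
   Context: For $\mathbf{u},\mathbf{v}\in\mathbb{F}_q^d$, $\mathbf{u}\cdot\mathbf{v}=\sum_{i=1}^d u_iv_i$ and $\|\mathbf{x}\|=\mathbf{x}\cdot\mathbf{x}$. For points $\mathbf{a},\mathbf{b},\mathbf{c}\in\mathbb{F}_q^d$, the spread $S(\mathbf{b},\mathbf{a},\mathbf{c})$ is $$S(\mathbf{b},\mathbf{a},\mathbf{c})=1-\frac{((\mathbf{b}-\mathbf{a})\cdot(\mathbf{c}-\mathbf{a}))^2}{\|\mathbf{b}-\mathbf{a}\|\,\|\mathbf{c}-\mathbf{a}\|},$$ undefined if either factor in the denominator is $0$. The spreads determined by $\mathcal{P}$ are the values $S(\mathbf{b},\mathbf{a},\mathbf{c})$ over all $\mathbf{a},\mathbf{b},\mathbf{c}\in\mathcal{P}$ for which it is defined. *)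

(* Defs.v *)
From mathcomp Require Import all_boot all_algebra.

Set Implicit Arguments.
Unset Strict Implicit.
Unset Printing Implicit Defensive.

Import GRing.Theory.
Local Open Scope ring_scope.

Definition prime_power (q : nat) : Prop :=
  exists p k : nat, [/\ prime p, (0 < k)%N & q = (p ^ k)%N].

Section Spread.
Variables (F : finFieldType) (d : nat).
Implicit Types (a b c u v x : 'rV[F]_d) (P : {set 'rV[F]_d}).

Definition dot u v : F := \sum_(i < d) u 0 i * v 0 i.

(* No square root is taken. *)
Definition qnorm x : F := dot x x.

(* [None] encodes an undefined spread. *)
Definition spread b a c : option F :=
  if (qnorm (b - a) == 0) || (qnorm (c - a) == 0) then None
  else Some (1 - dot (b - a) (c - a) ^+ 2 / (qnorm (b - a) * qnorm (c - a))).

(* The points a, b, c are not required to be distinct; a = b and a = c are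
   excluded anyway, since the spread is then undefined. *)
Definition spreads P : {set F} :=
  [set s | [exists a in P, exists b in P, exists c in P,
              spread b a c == Some s]].

End Spread.

(* Main.v *)
Require Import Defs.
From mathcomp Require Import all_boot all_algebra.
From mathcomp Require Import finfield zify.

(** Write d = 2m + 1.  If A is an m x m matrix with A A^T = -1, the vectors
    (u, uA) form a totally isotropic subspace of F^2m of dimension m, so on
    the (m+1)-dimensional subspace of all (u, uA, t) the dot product is t t'
    and every defined spread is 0.  When -1 is a square i^2, take A = i 1; when
    m is even, take A = [[a, b], [b, -a]] in blocks, where a^2 + b^2 = -1. *)

Set Implicit Arguments.
Unset Strict Implicit.
Unset Printing Implicit Defensive.

Import GRing.Theory.
Local Open Scope ring_scope.

Section FiniteField.
Variable F : finFieldType.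

(** With [#|F|] = 4k + 1, the polynomial X^(2k) - 1 has too few roots to vanish at all 4k nonzero
    elements. Where it does not vanish, x^(2k) is a square root of 1 other than 1, hence -1, and x^k
    is the root sought. *)
Lemma finField_sqrtN1 : (#|F| = 1 %[mod 4])%N -> exists i : F, i ^+ 2 = -1.
Proof.
move=> q1; have q_gt1 : (1 < #|F|)%N := finNzRing_gt1 F.
have [k def_q] : exists k, #|F| = (4 * k).+1%N by exists (#|F| %/ 4)%N; lia.
have k_gt0 : (0 < k)%N by lia.
have [x x_neq0 xk_neq1] : exists2 x : F, x != 0 & x ^+ k.*2 != 1.
  have [/existsP[x /andP[]]|all_roots] :=
    boolP [exists x : F, (x != 0) && (x ^+ k.*2 != 1)]; first by exists x.
  have : (size (enum (predC1 (0%R : F))) < size ('X^(k.*2) - 1%:P : {poly F})%R)%N.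
    apply: max_poly_roots; last exact: enum_uniq.
      by rewrite -size_poly_gt0 size_XnsubC ?double_gt0.
    apply/allP=> x; rewrite mem_enum inE => x_neq0.
    move: all_roots; rewrite negb_exists => /forallP/(_ x).
    by rewrite x_neq0 negbK rootE !hornerE subr_eq0.
  by rewrite -cardE cardC1 def_q size_XnsubC ?double_gt0 //; lia.
exists (x ^+ k); apply/eqP; rewrite -exprM muln2.
have : (x ^+ k.*2) ^+ 2 == 1.
  (* Multiplying by [x] reduces the claim to x^(4k+1) = x, which is [expf_card]. *)
  apply/eqP/(mulfI x_neq0); rewrite mulr1 -exprM -exprS.
  by rewrite -[RHS]expf_card def_q; congr (x ^+ _); lia.
by rewrite sqrf_eq1 (negPf xk_neq1).
Qed.

Definition squares : {set F} := [set x ^+ 2 | x : F].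

(** Every fibre of squaring lies in a set {x, -x}. *)
Lemma card_squares : (#|F| <= 2 * #|squares|)%N.
Proof.
rewrite -[#|F|]sum1_card.
rewrite (partition_big (fun x => x ^+ 2) (fun s => s \in squares)) /=; last first.
  by move=> x _; apply: imset_f.
rewrite mulnC -sum_nat_const; apply: leq_sum => s /imsetP[x _ ->].
apply: (@leq_trans #|[set x; - x]|); last by rewrite cards2; case: eqP.
rewrite sum1_card; apply: subset_leq_card; apply/subsetP=> y.
by rewrite !inE -eqf_sqr.
Qed.

(* Pigeonhole: the squares S and the set -1 - S each contain more than half of F. *)
Lemma finField_sum_sqr_N1 :
  odd #|F| -> exists a b : F, a ^+ 2 + b ^+ 2 = -1.
Proof.
move=> q_odd; pose T := [set -1 - s | s in squares].
have cardT : #|T| = #|squares| by rewrite card_imset // => s t /addrI/oppr_inj.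
have [disjST|] := boolP [disjoint squares & T].
  have leU : (#|squares :|: T| <= #|F|)%N := max_card _.
  move: disjST; rewrite -setI_eq0 => /eqP disjST.
  (* Disjointness would force [#|F|] to equal twice [#|squares|], against its oddness. *)
  have := cardsUI squares T; rewrite disjST cards0 cardT.
  by have := card_squares; lia.
case/pred0Pn=> z /andP[/imsetP[a _ ->] /imsetP[s /imsetP[b _ ->] eq_ab]].
by exists a, b; rewrite eq_ab subrK.
Qed.

Lemma dotE d (u v : 'rV[F]_d) : dot u v = (u *m v^T) 0 0.
Proof. by rewrite mxE; apply: eq_bigr => i _; rewrite mxE. Qed.

(** When the dot product has rank one on [P], the squared dot product of two differences equals the
    product of their norms, so each defined spread is 1 - 1 = 0. *)
Lemma spreads_le1 d (P : {set 'rV[F]_d}) (f : 'rV[F]_d -> F) :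
    {in P &, forall x y, x - y \in P} ->
    {in P &, forall x y, dot x y = f x * f y} ->
  (#|spreads P| <= 1)%N.
Proof.
move=> subP dotP; rewrite -(cards1 (0 : F)); apply: subset_leq_card.
apply/subsetP=> s; rewrite !inE => /existsP[a /andP[Pa]].
case/existsP=> b /andP[Pb] /existsP[c /andP[Pc]].
rewrite /spread; case: ifP => // /norP[b_neq0 c_neq0] /eqP[<-].
move: (mulf_neq0 b_neq0 c_neq0).
rewrite /qnorm !dotP ?subP // exprMn !expr2 => nz.
by rewrite divff ?subrr.
Qed.

Lemma exists_one_spread_set m (A : 'M[F]_m) :
    A *m A^T = (-1)%:M ->
  exists P : {set 'rV[F]_(m + m + 1)},
    #|P| = (#|F| ^ (m + 1))%N /\ (#|spreads P| <= 1)%N.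
Proof.
move=> AAt; pose g (ut : 'rV[F]_m * F) : 'rV_(m + m + 1) :=
  row_mx (row_mx ut.1 (ut.1 *m A)) ut.2%:M.
pose f (x : 'rV[F]_(m + m + 1)) := rsubmx x 0 0.
have fg ut : f (g ut) = ut.2 by rewrite /f row_mxKr mxE.
exists [set g ut | ut : 'rV[F]_m * F]; split.
  (* [g] is injective: its first and last blocks recover the pair. *)
  rewrite card_imset => [|[u s] [v t] /eq_row_mx[/eq_row_mx[/= -> _]]].
    by rewrite card_prod card_mx mul1n addn1 expnSr.
  by move/matrixP/(_ 0 0); rewrite !mxE !mulr1n => ->.
apply: (@spreads_le1 _ _ f) => _ _ /imsetP[ut _ ->] /imsetP[vt _ ->].
  apply/imsetP; exists (ut - vt) => //.
  by rewrite /g /= !opp_row_mx !add_row_mx mulmxBl raddfB.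
(* The middle block contributes u A A^T v^T = - u v^T, cancelling the first; only the product of
   last coordinates remains. *)
rewrite !fg dotE /g !tr_row_mx !mul_row_col trmx_mul mulmxA -(mulmxA ut.1) AAt.
by rewrite mul_mx_scalar -scalemxAl scaleN1r addrN add0r tr_scalar_mx
           -scalar_mxM mxE.
Qed.

End FiniteField.

Local Close Scope ring_scope.

Theorem theorem1p7 (q d : nat) (F : finFieldType)
    (hq : prime_power q) (hodd : odd q) (hF : #|F| = q) (hd : 3 <= d)
    (hqd : (q = 1 %[mod 4] /\ odd d) \/ (q = 3 %[mod 4] /\ d = 1 %[mod 4])) :
  exists P : {set 'rV[F]_d},
    #|P| = q ^ ((d + 1) %/ 2) /\ #|spreads P| <= 1.
Proof.
have {hd} [m def_d] : exists m, d = m + m + 1 by exists (d %/ 2); lia.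
subst d q; have -> : (m + m + 1 + 1) %/ 2 = m + 1 by lia.
case: hqd => [[q1 _]|[_ d1]].
  have [i i2] := finField_sqrtN1 q1.
  apply: (@exists_one_spread_set _ _ i%:M%R).
  by rewrite tr_scalar_mx -scalar_mxM -expr2 i2.
have [k def_m] : exists k, m = k + k by exists (m %/ 2); lia.
subst m; have [a [b ab]] := finField_sum_sqr_N1 hodd.
pose A : 'M[F]_(k + k) := block_mx a%:M b%:M b%:M (- a)%:M.
apply: (@exists_one_spread_set _ _ A).
(* [A] is symmetric; in its square the off-diagonal blocks cancel and the diagonal ones are a^2 +
   b^2 = -1. *)
rewrite /A tr_block_mx !tr_scalar_mx mulmx_block -!scalar_mxM -!raddfD /=.
rewrite -!expr2 sqrrN mulrN mulNr (mulrC b a) subrr [(b ^+ 2 + _)%R]addrC ab.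
by rewrite raddf0 -scalar_mx_block.
Qed.
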